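(* Let $G$ be a graph of order $n\geq 5\delta+6$ with minimum degree $\delta$. If $$\rho(G)\geq \rho\big(K_{\delta}\vee (K_{n-2\delta-1}+(\delta+1)K_1)\big),$$ then $G$ has a spanning subgraph each of whose components is isomorphic either to $K_2$ or to a cycle $C_k$ for some integer $k\geq 3$, unless $G\cong K_{\delta}\vee (K_{n-2\delta-1}+(\delta+1)K_1)$.
   Context: All graphs are finite, simple and undirected. $\rho(G)$ denotes the spectral radius of $G$, i.e. the largest eigenvalue of its adjacency matrix. $K_m$ is the complete graph on $m$ vertices, $C_k$ the cycle on $k$ vertices, $mK_1$ the edgeless graph on $m$ vertices, $G_1+G_2$ the disjoint union, and $G_1\vee G_2$ the join (disjoint union plus all edges between $V(G_1)$ and $V(G_2)$). *)

(* Defs.v *)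
From mathcomp Require Import all_boot all_order all_algebra.
From mathcomp Require Import spectral sesquilinear polyrcf complex.
From mathcomp Require Import boolp classical_sets reals.

Set Implicit Arguments.
Unset Strict Implicit.
Unset Printing Implicit Defensive.

Import Order.TTheory GRing.Theory Num.Theory.

Record sgraph (T : finType) := SGraph {
  adj :> rel T;
  adj_sym : symmetric adj;
  adj_irr : irreflexive adj }.

Definition giso (T U : finType) (G : sgraph T) (H : sgraph U) : Prop :=
  exists2 f : T -> U, bijective f & forall x y, H (f x) (f y) = G x y.

Definition complete_adj (m : nat) : rel 'I_m := fun i j => i != j.
Lemma complete_sym m : symmetric (@complete_adj m).
Proof. by move=> i j; rewrite /complete_adj eq_sym. Qed.
Lemma complete_irr m : irreflexive (@complete_adj m).
Proof. by move=> i; rewrite /complete_adj eqxx. Qed.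
Definition complete m := SGraph (@complete_sym m) (@complete_irr m).

Definition edgeless_adj (m : nat) : rel 'I_m := fun _ _ => false.
Lemma edgeless_sym m : symmetric (@edgeless_adj m).
Proof. by []. Qed.
Lemma edgeless_irr m : irreflexive (@edgeless_adj m).
Proof. by []. Qed.
Definition edgeless m := SGraph (@edgeless_sym m) (@edgeless_irr m).

(* ordS is the successor modulo k; this is the usual cycle only for k >= 3. *)
Definition cycle_adj (k : nat) : rel 'I_k :=
  fun i j => (i != j) && ((j == ordS i) || (i == ordS j)).
Lemma cycle_sym k : symmetric (@cycle_adj k).
Proof. by move=> i j; rewrite /cycle_adj eq_sym orbC. Qed.
Lemma cycle_irr k : irreflexive (@cycle_adj k).
Proof. by move=> i; rewrite /cycle_adj eqxx. Qed.
Definition cycle_graph k := SGraph (@cycle_sym k) (@cycle_irr k).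

Definition union_adj (T U : finType) (G : sgraph T) (H : sgraph U) :
  rel (T + U)%type := fun x y =>
  match x, y with
  | inl a, inl b => G a b
  | inr a, inr b => H a b
  | _, _ => false
  end.
Lemma union_sym (T U : finType) (G : sgraph T) (H : sgraph U) :
  symmetric (union_adj G H).
Proof. by case=> a [] b //=; rewrite adj_sym. Qed.
Lemma union_irr (T U : finType) (G : sgraph T) (H : sgraph U) :
  irreflexive (union_adj G H).
Proof. by case=> a /=; rewrite adj_irr. Qed.
Definition disjoint_union (T U : finType) (G : sgraph T) (H : sgraph U) :=
  SGraph (union_sym G H) (union_irr G H).

Definition join_adj (T U : finType) (G : sgraph T) (H : sgraph U) :
  rel (T + U)%type := fun x y =>
  match x, y with
  | inl a, inl b => G a b
  | inr a, inr b => H a b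
  | _, _ => true
  end.
Lemma join_sym (T U : finType) (G : sgraph T) (H : sgraph U) :
  symmetric (join_adj G H).
Proof. by case=> a [] b //=; rewrite adj_sym. Qed.
Lemma join_irr (T U : finType) (G : sgraph T) (H : sgraph U) :
  irreflexive (join_adj G H).
Proof. by case=> a /=; rewrite adj_irr. Qed.
Definition join (T U : finType) (G : sgraph T) (H : sgraph U) :=
  SGraph (join_sym G H) (join_irr G H).

Definition induced_adj (T : finType) (G : sgraph T) (A : {set T}) :
  rel {x : T | x \in A} :=
  fun x y => G (val x) (val y).
Lemma induced_sym (T : finType) (G : sgraph T) (A : {set T}) :
  symmetric (@induced_adj T G A).
Proof. by move=> x y; rewrite /induced_adj adj_sym. Qed.
Lemma induced_irr (T : finType) (G : sgraph T) (A : {set T}) :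
  irreflexive (@induced_adj T G A).
Proof. by move=> x; rewrite /induced_adj adj_irr. Qed.
Definition induced (T : finType) (G : sgraph T) (A : {set T}) :=
  SGraph (@induced_sym T G A) (@induced_irr T G A).

Definition component (T : finType) (G : sgraph T) (x : T) : {set T} :=
  [set y | connect G x y].

Definition spanning_subgraph (T : finType) (H G : sgraph T) : Prop :=
  forall x y, H x y -> G x y.

Definition has_K2_cycle_factor (T : finType) (G : sgraph T) : Prop :=
  exists2 H : sgraph T, spanning_subgraph H G &
    forall x : T,
      giso (induced H (component H x)) (complete 2) \/
      exists2 k, 3 <= k & giso (induced H (component H x)) (cycle_graph k).

Definition degree (T : finType) (G : sgraph T) (x : T) : nat := #|G x|.

(* Degrees are smaller than #|T|, so the default value only shows when T is
   empty. *)
Definition min_degree (T : finType) (G : sgraph T) : nat :=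
  \big[minn/#|T|]_(x : T) degree G x.

Local Open Scope ring_scope.

Definition adjacency (R : realType) (T : finType) (G : sgraph T) :
  'M[R]_#|T| := \matrix_(i, j) (G (enum_val i) (enum_val j))%:R.

(* The set of eigenvalues is finite and, for nonempty T, nonempty, so that the
   supremum is the largest eigenvalue: see rho_max. *)
Definition rho (R : realType) (T : finType) (G : sgraph T) : R :=
  sup [set a | eigenvalue (adjacency R G) a]%classic.

Lemma symmetric_eigenvalue (R : realType) n (A : 'M[R]_n) :
  (0 < n)%N -> A^T = A -> exists a, eigenvalue A a.
Proof.
case: n A => // n A _ symA; pose f := real_complex R.
have hermA : map_mx f A \is hermsymmx.
  apply: realsym_hermsym.
    apply/is_hermitianmxP; rewrite expr0 scale1r map_mx_id //.
    by apply/matrixP => i j; rewrite -[in LHS]symA !mxE.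
  by apply/mxOverP => i j; rewrite mxE; apply/complex_realP; exists (A i j).
set P := spectralmx (map_mx f A); set D := spectral_diag (map_mx f A).
have defA : map_mx f A = invmx P *m diag_mx D *m P.
  exact/orthomx_spectralP/hermitian_normalmx.
have unitP : P \in unitmx := spectral_unit _.
have /complex_realP[a Da] : D 0 0 \is Num.real.
  exact: (mxOverP (hermitian_spectral_diag_real hermA)).
exists a; rewrite eigenvalue_root_char -(fmorph_root f) map_char_poly.
rewrite -eigenvalue_root_char; apply/eigenvalueP; exists (row 0 P).
  rewrite {1}defA -row_mul !mulmxA mulmxV // mul1mx.
  by rewrite row_mul row_diag_mx -scalemxAl -rowE Da.
apply: contraTneq unitP => rowP0; rewrite -row_free_unit; apply/row_freePn.
by exists 0; rewrite rowP0 sub0mx.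
Qed.

Lemma rho_max (R : realType) (T : finType) (G : sgraph T) : (0 < #|T|)%N ->
  eigenvalue (adjacency R G) (rho R G) /\
  forall a, eigenvalue (adjacency R G) a -> a <= rho R G.
Proof.
set A := adjacency R G => T_gt0.
have symA : A^T = A by apply/matrixP => i j; rewrite !mxE adj_sym.
have [m Am le_m] : exists2 m, eigenvalue A m & forall a, eigenvalue A a -> a <= m.
  have [a0 Aa0] := symmetric_eigenvalue T_gt0 symA.
  have mem_s a : (a \in rootsR (char_poly A)) = eigenvalue A a.
    rewrite -roots_on_rootsR ?monic_neq0 ?char_poly_monic //.
    by rewrite eigenvalue_root_char in_itv.
  have s_a0 : a0 \in rootsR (char_poly A) by rewrite mem_s.
  have [m _ max_m] := arg_maxP (@ssval _ _) (isT : xpredT (SeqSub s_a0)).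
  exists (ssval m); first by rewrite -mem_s ssvalP.
  by move=> a; rewrite -mem_s => sa; have := max_m (SeqSub sa) isT.
suff -> : rho R G = m by [].
apply/eqP; rewrite eq_le; apply/andP; split.
  by apply: ge_sup; [exists m | move=> a /le_m].
by apply: ub_le_sup => //; exists m => a /le_m.
Qed.

(* Main.v *)
(* Matching each vertex to a neighbour injectively (Hall's theorem on the
   bipartite double cover) decomposes G into the orbits of an injection f with
   x adjacent to f x, that is, into edges and cycles.  If this fails, Hall gives
   a set S and an independent set B of #|S| + 1 vertices whose neighbours all
   lie in S; then delta <= #|S| and G lies in the graph K_s v (K_(n-2s-1) +
   (s+1)K_1) with s = #|S|.  The spectral radius of the latter graph is the
   largest root of an explicit cubic f_s.  The cubic f_delta has a root
   r >= n - delta - 2, and f_s - f_delta is positive at r for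
   delta < s <= (n - 1) / 2 as soon as n >= 5 delta + 6.  Testing G against the
   positive vector attached to f_s then shows that rho(G) >= r forces
   s = delta and G to be the whole extremal graph. *)
Require Import Defs.
From mathcomp Require Import boolp classical_sets reals.
From mathcomp Require Import all_boot all_order all_algebra.
From mathcomp Require Import zify ring lra.
Local Open Scope ring_scope.

Set Implicit Arguments.
Unset Strict Implicit.
Unset Printing Implicit Defensive.
Import Order.TTheory GRing.Theory Num.Theory.

(** * Hall's marriage theorem *)

Section Hall.
Local Open Scope nat_scope.

(** Induction on [#|A|]. If some nonempty proper subset [B] is tight, then [B] and [A :\: B] are
    matched separately, the latter outside the neighbourhood of [B]. Otherwise every such subset has
    a spare neighbour and one vertex can be matched arbitrarily. [u0] supplies values when [A] is
    empty. *)
Lemma hall_marriage (T U : finType) (u0 : U) (N : T -> {set U}) (A : {set T}) :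
    (forall B : {set T}, B \subset A -> #|B| <= #|\bigcup_(x in B) N x|) ->
  exists2 f : T -> U, {in A &, injective f} & {in A, forall x, f x \in N x}.
Proof.
have [m leAm] := ubnP #|A|; elim: m => // m IHm in N A leAm * => hallA.
have [->|[a Aa]] := set_0Vmem A.
  by exists (fun=> u0) => [x y|x]; rewrite inE.
have [/existsP[B /and3P[properB B_neq0 tightB]]|strictA] :=
    boolP [exists B : {set T}, [&& B \proper A, B != set0 &
             #|\bigcup_(x in B) N x| <= #|B|]].
  have sBA := proper_sub properB; set NB := \bigcup_(x in B) N x.
  have [||f1 inj1 N1] := IHm N B.
  - by rewrite -ltnS (leq_trans _ leAm) // ltnS proper_card.
  - by move=> C sCB; apply: hallA; apply: fintype.subset_trans sBA.
  have [||f2 inj2 N2] := IHm (fun x => N x :\: NB) (A :\: B).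
  - rewrite -ltnS (leq_trans _ leAm) // ltnS; apply: proper_card.
    rewrite properE subsetDl; apply/subsetPn.
    have [b Bb] := set0Pn _ B_neq0.
    by exists b; rewrite ?inE ?Bb ?(fintype.subsetP sBA).
  - move=> C; rewrite subsetD => /andP[sCA disCB].
    (* Hall's condition for [C] in the reduced family is the one for [C :|: B], less the at most
       [#|B|] elements of [NB]. *)
    have:= hallA (C :|: B); rewrite subUset sCA sBA => /(_ isT).
    have -> : #|C :|: B| = #|C| + #|B|.
      by rewrite cardsU (disjoint_setI0 disCB) cards0 subn0.
    have -> : \bigcup_(x in C :|: B) N x
            = (\bigcup_(x in C) (N x :\: NB)) :|: NB.
      apply/setP=> y; rewrite inE; apply/bigcupP/orP.
        case=> x; rewrite inE => CBx Nxy; have [NBy|NBy] := boolP (y \in NB).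
          by right.
        left; case/orP: CBx => [Cx|Bx].
          by apply/bigcupP; exists x => //; rewrite inE NBy.
        by case/negP: NBy; apply/bigcupP; exists x.
      case=> /bigcupP[x Cx]; first by rewrite inE => /andP[_ Nxy];
        exists x; rewrite // inE Cx.
      by exists x; rewrite // inE Cx orbT.
    rewrite cardsU => /leq_trans/(_ (leq_subr _ _)) => le_sum.
    by rewrite -(leq_add2r #|B|) (leq_trans le_sum) // leq_add2l.
  have f2NB x : x \in A -> x \notin B -> f2 x \notin NB.
    by move=> Ax Bx; have:= N2 x; rewrite !inE Ax Bx => /(_ isT)/andP[].
  have f1NB x : x \in B -> f1 x \in NB.
    by move=> Bx; apply/bigcupP; exists x => //; apply: N1.
  exists (fun x => if x \in B then f1 x else f2 x) => [x y|x] Ax.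
    move=> Ay; case: ifPn => Bx; case: ifPn => By.
    - exact: inj1.
    - by move=> e; case/negP: (f2NB y Ay By); rewrite -e f1NB.
    - by move=> e; case/negP: (f2NB x Ax Bx); rewrite e f1NB.
    - by apply: inj2; rewrite inE ?Bx ?By.
  case: ifPn => Bx; first exact: N1.
  by have:= N2 x; rewrite !inE Ax Bx => /(_ isT)/andP[].
have: 0 < #|\bigcup_(x in [set a]) N x|.
  by apply: leq_trans (hallA [set a] _); rewrite ?cards1 // sub1set.
rewrite big_set1 => /card_gt0P[y Nay].
have [||f injf Nf] := IHm (fun x => N x :\ y) (A :\ a).
- by rewrite -ltnS (leq_trans _ leAm) // [#|A|](cardsD1 a) Aa.
- move=> B sB; have [->|B_neq0] := eqVneq B set0; first by rewrite cards0.
  (* The surplus of one pays for the deletion of [y]. *)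
  have ltB : #|B| < #|\bigcup_(x in B) N x|.
    rewrite ltnNge; apply: contra strictA => tightB.
    apply/existsP; exists B; rewrite B_neq0 tightB !andbT.
    exact: sub_proper_trans sB (properD1 Aa).
  have -> : \bigcup_(x in B) (N x :\ y) = (\bigcup_(x in B) N x) :\ y.
    apply/setP=> z; rewrite !inE; apply/bigcupP/andP.
      by case=> x Bx; rewrite !inE => /andP[zy Nz]; split=> //; apply/bigcupP; exists x.
    by case=> zy /bigcupP[x Bx Nz]; exists x; rewrite // !inE zy.
  by move: ltB; rewrite (cardsD1 y (\bigcup_(x in B) N x)); case: (_ \in _) => //= /ltnW.
have fy x : x \in A -> x != a -> f x != y /\ f x \in N x.
  by move=> Ax xa; have:= Nf x; rewrite !inE Ax xa => /(_ isT)/andP[].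
exists (fun x => if x == a then y else f x) => [x z|x] Ax.
  move=> Az; case: eqVneq => [->|xa]; case: eqVneq => [->|za] //.
  - by move=> e; case: (fy z Az za); rewrite e eqxx.
  - by move=> e; case: (fy x Ax xa); rewrite e eqxx.
  - by apply: injf; rewrite !inE ?xa ?za.
by case: eqVneq => [->|xa] //; case: (fy x Ax xa).
Qed.

End Hall.

(** * Components given by the orbits of an injection *)

Section Factor.
Local Open Scope nat_scope.

(** The reduction modulo the order acts only at the last index of the orbit, where [iter_order]
    leads back to [x]. *)
Lemma ordS_findex (T : finType) (f : T -> T) (injf : injective f) (x y : T)
    (xy : fconnect f x y) (xfy : fconnect f x (f y)) :
  ordS (Ordinal (findex_max xy)) = Ordinal (findex_max xfy).
Proof.
apply/val_inj => /=; set k := order f x; set i := findex f x y.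
have lti : i < k := findex_max xy.
have ky : iter i f x = y := iter_findex xy.
have -> : f y = iter (i.+1 %% k) f x.
  have [e|ne] := eqVneq i.+1 k; last by rewrite modn_small 1?ltn_neqAle ?ne //= ky.
  by rewrite -ky -iterS e modnn /= iter_order.
by rewrite findex_iter // ltn_pmod // order_gt0.
Qed.

Variables (T : finType) (f : T -> T).
Hypotheses (injf : injective f) (f_neq : forall x, f x != x).

Definition orbit_adj : rel T := fun x y => (y == f x) || (x == f y).

Lemma orbit_adj_sym : symmetric orbit_adj.
Proof. by move=> x y; rewrite /orbit_adj orbC. Qed.

Lemma orbit_adj_irr : irreflexive orbit_adj.
Proof. by move=> x; rewrite /orbit_adj orbb eq_sym (negbTE (f_neq x)). Qed.

Definition orbit_graph := SGraph orbit_adj_sym orbit_adj_irr.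

(** On a finite type injectivity makes [fconnect] symmetric, so traversing arcs backwards connects
    nothing new. *)
Lemma connect_orbit_graph : connect orbit_graph =2 fconnect f.
Proof.
suff [sub12 sub21] : subrel orbit_graph (connect (frel f))
    /\ subrel (frel f) (connect orbit_graph).
  by move=> x y; apply/idP/idP; [apply: connect_sub sub12 x y|apply: connect_sub sub21 x y].
split=> x y /=; last by move=> /eqP <-; apply: connect1; rewrite /= /orbit_adj eqxx.
case/orP=> /eqP->; first exact: fconnect1.
by rewrite fconnect_sym //; apply: fconnect1.
Qed.

(** Sending [y] to its index along the orbit of [x] turns [f] into [ordS]. Orbits of length 2 are
    covered too: they give [cycle_graph 2], a single edge. *)
Lemma orbit_component_iso x :
  giso (induced orbit_graph (component orbit_graph x)) (cycle_graph (order f x)).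
Proof.
set C := component _ _.
have memC y : (y \in C) = fconnect f x y by rewrite inE connect_orbit_graph.
have xC (y : {y | y \in C}) : fconnect f x (val y) by rewrite -memC (valP y).
have Cx (i : 'I_(order f x)) : iter i f x \in C by rewrite memC fconnect_iter.
pose g (y : {y | y \in C}) := Ordinal (findex_max (xC y)).
pose h i : {y | y \in C} := Sub (iter (nat_of_ord i) f x) (Cx i).
have gK : cancel g h by move=> y; apply: val_inj; rewrite /= (iter_findex (xC y)).
have hK : cancel h g.
  by move=> i; apply: val_inj; rewrite /= findex_iter ?ltn_ord.
have gS y z : (g z == ordS (g y)) = (val z == f (val y)).
  have fyC : f (val y) \in C by rewrite memC (connect_trans (xC y)) ?fconnect1.
  pose w : {y | y \in C} := Sub (f (val y)) fyC.
  have -> : ordS (g y) = g w by apply: ordS_findex.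
  by rewrite (can_eq gK) -val_eqE.
exists g => [|y z]; first by exists h.
rewrite /= /cycle_adj /induced_adj /= /orbit_adj !gS (can_eq gK) -val_eqE.
case: eqVneq => //= ->.
by rewrite orbb eq_sym (negbTE (f_neq _)).
Qed.

Lemma cycle2_complete : cycle_graph 2 =2 complete 2.
Proof. by case=> [[|[]]] // ? [[|[]]]. Qed.

Lemma orbit_factor (G : sgraph T) :
  (forall x, G x (f x)) -> has_K2_cycle_factor G.
Proof.
move=> Gf; exists orbit_graph => [x y /orP[]/eqP->|x] //; first by rewrite adj_sym.
have iso := orbit_component_iso x.
have: 1 < order f x.
  rewrite ltn_neqAle order_gt0 andbT; apply: contraNneq (f_neq x) => e.
  by have:= iter_order injf x; rewrite -e /= => ->.
rewrite leq_eqVlt => /orP[/eqP e|]; last by right; exists (order f x).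
left; move: iso; rewrite -e => -[g bij_g gP]; exists g => // y z.
by rewrite -cycle2_complete.
Qed.

End Factor.

(** From a Hall violator [A] with neighbourhood [NA], take [S] to be [NA :\: A] and cut [B] out of
    [A :\: NA]. A neighbour in [A] of a vertex of [A] would put that vertex in [NA], so the
    neighbours of [B] avoid [A]. *)
Lemma no_factor_barrier (T : finType) (G : sgraph T) :
  ~ has_K2_cycle_factor G ->
  exists S B : {set T}, [/\ [disjoint S & B], #|B| = #|S|.+1 &
    forall x y, x \in B -> G x y -> y \in S].
Proof.
move=> nofactor.
have [/existsP[A]|allA] := boolP [exists A : {set T},
    (#|\bigcup_(x in A) [set y | G x y]| < #|A|)%N]; last first.
  case: nofactor; case: (pickP (@predT T)) => [x0 _|noT]; last first.
    (* An empty vertex type offers no default value for [hall_marriage]; there [id] meets the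
       adjacency conditions vacuously. *)
    by apply: (@orbit_factor _ id) => // x; have:= noT x.
  have [B _|f injf Nf] := @hall_marriage _ _ x0 (fun x => [set y | G x y]) setT.
    by rewrite leqNgt; apply: contra allA => ?; apply/existsP; exists B.
  have Gf x : G x (f x) by have:= Nf x (in_setT x); rewrite inE.
  apply: (@orbit_factor _ f) => // [x y|x]; first by apply: injf; rewrite inE.
  by apply: contraTneq (Gf x) => ->; rewrite adj_irr.
set NA := \bigcup_(x in A) _ => ltA.
have NAP x y : x \in A -> G x y -> y \in NA.
  by move=> Ax Gxy; apply/bigcupP; exists x; rewrite ?inE.
(* Both sets lose the same intersection, so the deficiency survives. *)
have leB : (#|NA :\: A| < #|A :\: NA|)%N.
  by rewrite -(ltn_add2l #|A :&: NA|) cardsID finset.setIC cardsID.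
have: (0 < #|[set B : {set T} | B \subset A :\: NA & #|B| == #|NA :\: A|.+1]|)%N.
  by rewrite cards_draws bin_gt0.
case/card_gt0P=> B; rewrite inE => /andP[sB /eqP cardB].
exists (NA :\: A), B; split=> // [|x y /(fintype.subsetP sB)].
  rewrite -setI_eq0; apply/eqP/setP=> x; rewrite !inE.
  by apply/negP=> /andP[/andP[/negP Ax _]] /(fintype.subsetP sB); rewrite inE => /andP[_ /Ax].
rewrite !inE => /andP[NAx Ax] Gxy; rewrite (NAP x) // andbT.
by apply: contra NAx => Ay; apply: (NAP y) => //; rewrite adj_sym.
Qed.

(** * Eigenvectors as functions on vertices; comparison with a supergraph *)

Lemma eigenvalue_adjacencyP (R : realType) (T : finType) (G : sgraph T) a :
  eigenvalue (adjacency R G) a <->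
  exists2 u : T -> R, exists x, u x != 0 &
    forall x, \sum_y (G x y)%:R * u y = a * u x.
Proof.
split=> [/eigenvalueP[v vA v_neq0]|[u [x ux] uG]].
  exists (fun x => v 0 (enum_rank x)) => [|x].
    have [i vi] : exists i, v 0 i != 0.
      apply/existsP; apply: contraNT v_neq0 => /existsPn v0.
      by apply/eqP/rowP=> i; rewrite mxE; apply/eqP; rewrite -[_ == _]negbK v0.
    by exists (enum_val i); rewrite enum_valK.
  have /rowP/(_ (enum_rank x)) := vA; rewrite !mxE => <-.
  rewrite (reindex _ (onW_bij _ (enum_rank_bij T))) /=.
  by apply: eq_bigr => y _; rewrite !mxE !enum_rankK adj_sym mulrC.
apply/eigenvalueP; exists (\row_i u (enum_val i)).
  apply/rowP=> i; rewrite !mxE -uG (reindex _ (onW_bij _ (enum_val_bij T))) /=.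
  by apply: eq_bigr => j _; rewrite !mxE adj_sym mulrC.
apply: contraNneq ux => /rowP/(_ (enum_rank x)).
by rewrite !mxE enum_rankK => ->.
Qed.

Lemma eigenvalue_subgraph (R : realType) (T : finType) (G M : sgraph T)
    (z : T -> R) (r lam : R) :
    spanning_subgraph G M -> (forall x, 0 < z x) ->
    (forall x, \sum_y (M x y)%:R * z y <= r * z x) ->
    eigenvalue (adjacency R G) lam -> r <= lam ->
  exists2 u : T -> R,
    [/\ forall x, 0 <= u x, exists x, u x != 0
      & forall x, \sum_y (M x y)%:R * u y = r * u x] &
    (forall x, \sum_y (M x y)%:R * z y < r * z x -> u x = 0) /\
    (forall x y, M x y -> ~~ G x y -> u y = 0).
Proof.
move=> sGM z_gt0 Mz /eigenvalue_adjacencyP[v [x0 vx0] vG] le_r.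
(* With u = |v|, the defects a, b, c of the inequalities r u <= G u,
   G u <= M u and M z <= r z, weighted by z, z and u, add up to
   z^T M u - u^T M z = 0, so each of them vanishes. *)
pose u x := `|v x|; have u_ge0 x : 0 <= u x by apply: normr_ge0.
have le_GM x y : (G x y)%:R <= (M x y)%:R :> R.
  by rewrite ler_nat; case: (boolP (G x y)) => // /sGM ->.
pose a x := z x * (\sum_y (G x y)%:R * u y - r * u x).
pose b x := z x * (\sum_y ((M x y)%:R - (G x y)%:R) * u y).
pose c x := u x * (r * z x - \sum_y (M x y)%:R * z y).
(* Pointwise, r |v| <= lam |v| <= |lam v| = |G v| <= G |v|, the last step being the triangle
   inequality. *)
have a_ge0 x : 0 <= a x.
  rewrite mulr_ge0 ?(ltW (z_gt0 x)) // subr_ge0.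
  apply: (@le_trans _ _ (lam * u x)); first by rewrite ler_wpM2r.
  rewrite (le_trans (ler_norm _)) // normrM normr_id -normrM -vG.
  apply: le_trans (ler_norm_sum _ _ _) _; apply: ler_sum => y _.
  by rewrite normrM normr_nat.
have t_ge0 x y : 0 <= ((M x y)%:R - (G x y)%:R) * u y.
  by rewrite mulr_ge0 // subr_ge0.
have b_ge0 x : 0 <= b x by rewrite mulr_ge0 ?(ltW (z_gt0 x)) ?sumr_ge0.
have c_ge0 x : 0 <= c x by rewrite mulr_ge0 // subr_ge0.
have sum0 : \sum_x (a x + b x + c x) = 0.
  have eq x : a x + b x + c x =
     \sum_y (M x y)%:R * (z x * u y) - \sum_y (M x y)%:R * (u x * z y).
    have -> : b x = z x * (\sum_y (M x y)%:R * u y)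
                    - z x * (\sum_y (G x y)%:R * u y).
      rewrite -mulrBr -sumrB; congr (_ * _); apply: eq_bigr => y _.
      by rewrite mulrBl.
    transitivity (z x * (\sum_y (M x y)%:R * u y)
                  - u x * (\sum_y (M x y)%:R * z y)).
      rewrite /a /c; ring.
    by rewrite !mulr_sumr; congr (_ - _); apply: eq_bigr => y _; ring.
  under eq_bigr do rewrite eq.
  rewrite sumrB exchange_big; apply/eqP; rewrite subr_eq0; apply/eqP.
  apply: eq_bigr => x _; apply: eq_bigr => y _ /=; rewrite adj_sym; ring.
have abc0 x : [/\ a x = 0, b x = 0 & c x = 0].
  have : a x + b x + c x = 0.
    move: x (isT : true); apply/psumr_eq0P=> // x _.
    by rewrite !addr_ge0.
  by move: (a_ge0 x) (b_ge0 x) (c_ge0 x) => *; split; lra.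
have z_neq0 x : z x != 0 by rewrite gt_eqF.
have t0 x y : ((M x y)%:R - (G x y)%:R) * u y = 0.
  case: (abc0 x) => _ /eqP; rewrite /b mulf_eq0 (negbTE (z_neq0 x)) => /eqP bx _.
  by move: y (isT : true); apply: psumr_eq0P bx.
exists u; split=> //.
- by exists x0; rewrite normr_eq0.
- move=> x; transitivity (\sum_y (G x y)%:R * u y).
    by apply: eq_bigr => y _; have:= t0 x y; lra.
  case: (abc0 x) => /eqP; rewrite /a mulf_eq0 (negbTE (z_neq0 x)) /=.
  by rewrite subr_eq0 => /eqP.
- move=> x lt_x; case: (abc0 x) => _ _ /eqP; rewrite /c mulf_eq0 subr_eq0.
  by rewrite (gt_eqF lt_x) orbF => /eqP.
- move=> x y Mxy nGxy; have:= t0 x y; rewrite Mxy (negbTE nGxy) subr0.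
  by rewrite mul1r.
Qed.

(** * The barrier graph and its quotient matrix *)

Section Barrier.

Variables (T : finType) (S B : {set T}).

(** For disjoint [S] and [B] with [#|B| = #|S|.+1] this is K_s v (K_(n-2s-1) + (s+1)K_1), drawn on
    the vertices of [G] so that [G] becomes a spanning subgraph of it. *)
Definition barrier_adj : rel T := fun x y =>
  (x != y) && [|| x \in S, y \in S | (x \notin B) && (y \notin B)].

Lemma barrier_adj_sym : symmetric barrier_adj.
Proof.
by move=> x y; rewrite /barrier_adj eq_sym orbCA [(y \notin B) && _]andbC.
Qed.

Lemma barrier_adj_irr : irreflexive barrier_adj.
Proof. by move=> x; rewrite /barrier_adj eqxx. Qed.

Definition barrier := SGraph barrier_adj_sym barrier_adj_irr.

Lemma sub_barrier (G : sgraph T) :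
  (forall x y, x \in B -> G x y -> y \in S) -> spanning_subgraph G barrier.
Proof.
move=> BS x y Gxy; rewrite /= /barrier_adj.
have [exy|_] := eqVneq x y; first by rewrite exy adj_irr in Gxy.
have [|Bx] := boolP (x \in B); first by move=> /BS/(_ Gxy) ->; rewrite orbT.
have [/BS|By] := boolP (y \in B); last by rewrite !orbT.
by rewrite adj_sym in Gxy; move=> /(_ x Gxy) ->.
Qed.

Hypothesis (disjSB : [disjoint S & B]) (cardB : #|B| = #|S|.+1).
Variable R : realType.
Let s : R := #|S|%:R.
Let n : R := #|T|%:R.

(* The arguments a, b, c are the values on S, on the rest and on B. *)
Definition barrier_fun (a b c : R) : T -> R :=
  fun x => if x \in S then a else if x \in B then c else b.

(** The partition into [S], the rest and [B] is equitable; the three coefficients lists are the rows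
    of its quotient matrix. *)
Lemma sum_barrier_fun (a b c : R) (x : T) :
  \sum_y (barrier x y)%:R * barrier_fun a b c y =
  barrier_fun ((s - 1) * a + (n - 2 * s - 1) * b + (s + 1) * c)
              (s * a + (n - 2 * s - 2) * b) (s * a) x.
Proof.
set w := barrier_fun a b c.
have SB y : y \in S -> (y \in B) = false.
  by move=> Sy; apply: (disjointFr disjSB).
have sumS : \sum_y (y \in S)%:R * w y = s * a.
  rewrite (eq_bigr (fun y => if y \in S then a else 0)) => [|y _].
    by rewrite -big_mkcond sumr_const mulr_natl.
  by rewrite /w /barrier_fun; case: (y \in S); rewrite ?mul1r ?mul0r.
have sumB : \sum_y (y \in B)%:R * w y = (s + 1) * c.
  rewrite (eq_bigr (fun y => if y \in B then c else 0)) => [|y _].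
    by rewrite -big_mkcond sumr_const cardB -[LHS]mulr_natl -natr1.
  rewrite /w /barrier_fun; case: ifPn => [/SB ->|_]; first by rewrite mul0r.
  by case: (y \in B); rewrite ?mul1r ?mul0r.
have sumR : \sum_y ((y \notin S) && (y \notin B))%:R * w y = (n - 2 * s - 1) * b.
  rewrite (eq_bigr (fun y => if y \in ~: (S :|: B) then b else 0)) => [|y _].
    rewrite -big_mkcond sumr_const -[LHS]mulr_natl; congr (_ * _).
    have:= cardsC (S :|: B); rewrite cardsU (disjoint_setI0 disjSB) cards0.
    by rewrite subn0 cardB /n /s => <-; rewrite !natrD -natr1; ring.
  rewrite !inE negb_or /w /barrier_fun.
  by case: (y \in S); case: (y \in B); rewrite ?mul1r ?mul0r.
have sumx : \sum_y (y == x)%:R * w y = w x.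
  rewrite (bigD1 x) //= eqxx mul1r big1 ?addr0 // => y /negbTE->.
  by rewrite mul0r.
(* The row of [x] is [S], plus [B] if [x] is in [S], plus the rest without [B] if [x] is not in [B];
   the last term removes the loop at [x]. *)
transitivity (\sum_y ((y \in S)%:R * w y
   + ((x \in S)%:R * ((y \in B)%:R * w y)
   + ((x \notin B)%:R * (((y \notin S) && (y \notin B))%:R * w y)
   - (x \notin B)%:R * ((y == x)%:R * w y))))).
  apply: eq_bigr => y _; rewrite /= /barrier_adj eq_sym.
  have [->|nyx] := eqVneq y x; rewrite ?eqxx ?nyx //=.
    case: (boolP (x \in S)) => [/SB ->|]; case: (x \in B) => //= *; ring.
  case: (boolP (x \in S)) => [/SB ->|] /=; case: (boolP (y \in S)) => [/SB ->|] /=;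
    case: (x \in B); case: (y \in B) => //= *; ring.
rewrite !big_split /= sumrN -!mulr_sumr sumS sumB sumR sumx /w /barrier_fun.
case: (boolP (x \in S)) => [/SB ->|_] /=; first by ring.
case: (x \in B) => /=; ring.
Qed.

(* The characteristic polynomial of the quotient matrix of barrier S B on the
   partition (S, rest, B), where s = #|S| and n = #|T|. *)
Definition barrier_cubic (n s r : R) : R :=
  r ^+ 3 - (n - s - 3) * r ^+ 2 - (n - 2 + s ^+ 2) * r
  + s * (s + 1) * (n - 2 * s - 2).

(** [w] solves the eigenvalue equations on the rest and on [B] identically in [r]; the equation on
    [S] then fails by exactly the cubic. *)
Lemma sum_barrier_vector (r : R) (x : T) :
    let w := barrier_fun (r * (r - (n - 2 * s - 2))) (s * r)
                         (s * (r - (n - 2 * s - 2))) in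
  \sum_y (barrier x y)%:R * w y
    = r * w x - (x \in S)%:R * barrier_cubic n s r.
Proof.
rewrite /= sum_barrier_fun /barrier_fun /barrier_cubic.
case: (x \in S) => /=; first by ring.
case: (x \in B) => /=; ring.
Qed.

End Barrier.

(** * Perron-Frobenius arguments for the barrier graph *)

Section Extremal.

Variables (T : finType) (S B : {set T}).
Hypothesis (disjSB : [disjoint S & B]) (cardB : #|B| = #|S|.+1).
Variable R : realType.
Let s : R := #|S|%:R.
Let n : R := #|T|%:R.
Local Notation M := (barrier S B).

(** Positivity spreads along edges, through a vertex of [S] or, if [S] is empty, inside the clique
    outside [B]. Asking for an edge [M x y] leaves out isolated vertices, such as those of [B] when
    [S] is empty. *)
Lemma barrier_eigenvector_gt0 (u : T -> R) (r : R) :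
    (forall x, 0 <= u x) -> (exists x, u x != 0) -> 0 < r ->
    (forall x, \sum_y (M x y)%:R * u y = r * u x) ->
  forall x y, M x y -> 0 < u y.
Proof.
move=> u_ge0 [x0 ux0] r_gt0 Mu.
have ux0_gt0 : 0 < u x0 by rewrite lt0r ux0 u_ge0.
have t_ge0 x y : 0 <= (M x y)%:R * u y by rewrite mulr_ge0.
have step x y : M x y -> 0 < u y -> 0 < u x.
  move=> Mxy uy; rewrite -(pmulr_rgt0 _ r_gt0) -Mu (bigD1 y) // Mxy mul1r.
  by rewrite ltr_pwDl // sumr_ge0.
(* When [S] is empty, this neighbour shows that [x0] is not in [B]. *)
have nbr : exists2 y, M x0 y & 0 < u y.
  apply/exists2P; apply: contrapT => /forallNP noy.
  have: 0 < \sum_y (M x0 y)%:R * u y by rewrite Mu mulr_gt0.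
  rewrite big1 ?ltxx // => y _.
  case Mxy: (M x0 y); last by rewrite mul0r.
  have [->|uy] := eqVneq (u y) 0; first by rewrite mulr0.
  by case: (noy y); rewrite Mxy lt0r uy u_ge0.
move=> x y; have [S0|[c Sc]] := set_0Vmem S; last first.
  have uc : 0 < u c.
    have [<-//|ncx] := eqVneq x0 c.
    by apply: (step _ x0) => //; rewrite /= /barrier_adj eq_sym ncx Sc.
  have [-> //|nyc _] := eqVneq y c.
  by apply: (step _ c) => //; rewrite /= /barrier_adj nyc Sc orbT.
case: nbr => y0; rewrite /= /barrier_adj S0 !inE /= => /and3P[_ Bx0 _] _.
move=> /and3P[_ _ By]; have [-> //|nyx] := eqVneq y x0.
by apply: (step _ x0) => //; rewrite /= /barrier_adj nyx By Bx0 !orbT.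
Qed.

(** [eigenvalue_subgraph] gives an eigenvector [u] of [M] that vanishes at the ends of edges missing
    from [G] and wherever the test vector [z] has a strict defect. As [u] is positive at
    non-isolated vertices, no edge is missing and the defect on [S], the cubic, is zero. *)
Lemma barrier_maximal (G : sgraph T) (r lam : R) :
    spanning_subgraph G M -> 0 < r -> (S != set0 -> n - 2 * s - 2 < r) ->
    (S = set0 -> n - 2 <= r) -> 0 <= barrier_cubic n s r ->
    eigenvalue (adjacency R G) lam -> r <= lam ->
  (forall x y, G x y = M x y) /\ (S != set0 -> barrier_cubic n s r = 0).
Proof.
move=> sGM r_gt0 r_gt S0 cubic_ge0 Glam le_r.
have s_ge0 : 0 <= s by [].
(* For empty [S] the second vector would be zero, since s = 0; the constant vector replaces it. *)
pose z := if S == set0 then barrier_fun S B 1 1 1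
  else barrier_fun S B (r * (r - (n - 2 * s - 2))) (s * r)
                       (s * (r - (n - 2 * s - 2))).
have z_gt0 x : 0 < z x.
  rewrite /z; case: eqVneq => [_|Sn0]; rewrite /barrier_fun.
    by case: ifP => // _; case: ifP.
  have s_gt0 : 0 < s by rewrite ltr0n card_gt0.
  by case: ifP => _; [|case: ifP => _]; apply: mulr_gt0; rewrite ?subr_gt0 ?r_gt.
have Mz x : \sum_y (M x y)%:R * z y =
    r * z x - (if S == set0 then (if x \in B then r else r - (n - 2))
               else (x \in S)%:R * barrier_cubic n s r).
  rewrite /z; case: eqVneq => [eS|_]; last exact: sum_barrier_vector.
  rewrite sum_barrier_fun // /barrier_fun eS inE cards0.
  by case: (x \in B); rewrite -/n; ring.
have [|u [u_ge0 un0 Mu] [u0 uG]] := eigenvalue_subgraph sGM z_gt0 _ Glam le_r.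
  move=> x; rewrite Mz lerBlDr lerDl; case: eqP => [/S0 ?|_].
    by case: ifP => _; [apply: ltW|rewrite subr_ge0].
  by rewrite mulr_ge0.
have u_gt0 := barrier_eigenvector_gt0 u_ge0 un0 r_gt0 Mu.
split=> [x y|Sn0].
  apply/idP/idP => [/sGM //|Mxy]; apply: contraLR (u_gt0 _ _ Mxy).
  by move=> /(uG _ _ Mxy) ->; rewrite ltxx.
have [c Sc] := set0Pn _ Sn0.
have [b Bb] : exists b, b \in B by apply/card_gt0P; rewrite cardB.
have Mbc : M b c.
  rewrite /= /barrier_adj Sc orbT andbT.
  by apply: contraTneq Bb => ->; rewrite (disjointFr disjSB).
apply/eqP; rewrite eq_le cubic_ge0 andbT leNgt; apply/negP => cubic_gt0.
have := u_gt0 _ _ Mbc; rewrite u0 ?ltxx // Mz (negbTE Sn0) Sc mul1r.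
by rewrite ltrBlDr ltrDl.
Qed.

Lemma barrier_eigenvalue (r : R) :
    0 < r -> (S != set0 -> n - 2 * s - 2 < r) -> barrier_cubic n s r = 0 ->
    (S = set0 -> r = n - 2) ->
  eigenvalue (adjacency R M) r.
Proof.
move=> r_gt0 r_gt cubic0 S0; apply/eigenvalue_adjacencyP.
have [eS|Sn0] := eqVneq S set0.
  exists (barrier_fun S B 1 1 0) => [|x].
    (* If [B] were everything, n would be 1 and r = n - 2 negative. *)
    have [x nBx] : exists x, x \notin B.
      apply: contrapT => /forallNP allB; move: r_gt0; rewrite (S0 eS) /n.
      have -> : #|T| = #|B| by apply: eq_card => x; apply/esym/negPn/negP/allB.
      by rewrite cardB eS cards0 ltNge; apply/negP; lra.
    by exists x; rewrite /barrier_fun (negbTE nBx) if_same oner_neq0.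
  rewrite sum_barrier_fun // -/n -/s (S0 eS) /barrier_fun /s eS inE cards0.
  by case: (x \in B); ring.
exists (barrier_fun S B (r * (r - (n - 2 * s - 2))) (s * r)
                        (s * (r - (n - 2 * s - 2)))) => [|x].
  have [c Sc] := set0Pn _ Sn0.
  by exists c; rewrite /barrier_fun Sc gt_eqF // mulr_gt0 // subr_gt0 r_gt.
by rewrite sum_barrier_vector // cubic0 mulr0 subr0.
Qed.

End Extremal.

(** * Estimates for the cubic *)

Lemma barrier_cubic_root (R : realType) (n d : R) :
    0 <= d -> 5 * d + 6 <= n ->
  exists2 r : R, n - d - 2 <= r & barrier_cubic n d r = 0.
Proof.
move=> d_ge0 n_ge.
pose p : {poly R} := 'X^3 - (n - d - 3) *: 'X^2 - (n - 2 + d ^+ 2) *: 'X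
                   + (d * (d + 1) * (n - 2 * d - 2))%:P.
have pE r : p.[r] = barrier_cubic n d r by rewrite /p /barrier_cubic !hornerE.
(* n - d - 2 is the spectral radius of the clique K_(n-d-1) formed by [S] and the rest. *)
have [||r] := @poly_ivt _ p (n - d - 2) n.
- by lra.
- rewrite !pE; apply/andP; split.
    have -> : barrier_cubic n d (n - d - 2) = - (d * d * (d + 1)).
      by rewrite /barrier_cubic; ring.
    by rewrite oppr_le0 !mulr_ge0 // addr_ge0.
  have -> : barrier_cubic n d n =
      (d + 2) * n ^+ 2 + 2 * n - d ^+ 2 * n + d * (d + 1) * (n - 2 * d - 2).
    by rewrite /barrier_cubic; ring.
  have n_ge0 : 0 <= n by lra.
  have h1 : 0 <= d * (d + 1) * (n - 2 * d - 2) by rewrite !mulr_ge0 //; lra.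
  have h2 : 0 <= n * (d * (n - d)) by rewrite !mulr_ge0 //; lra.
  have h3 : 0 <= n ^+ 2 by rewrite exprn_ge0.
  by nra.
by move=> /andP[le_r _] /rootP; rewrite pE; exists r.
Qed.

(** The difference is s - d times a cofactor that increases with r from n - d - 2 on. At r = n - d -
    2 the cofactor decreases in s, and at s = (n - 1) / 2 it is at least 5 (d + 1) / 2 by n >= 5 d +
    6. *)
Lemma barrier_cubic_incr (R : realType) (n d s r : R) :
    0 <= d -> 5 * d + 6 <= n -> d + 1 <= s -> 2 * s + 1 <= n ->
    n - d - 2 <= r ->
  barrier_cubic n d r < barrier_cubic n s r.
Proof.
move=> d_ge0 n_ge s_gt s_le r_ge; rewrite -subr_gt0.
have -> : barrier_cubic n s r - barrier_cubic n d r =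
    (s - d) * (r ^+ 2 - (s + d) * r + (s + d + 1) * (n - 2)
               - 2 * (s ^+ 2 + s * d + d ^+ 2) - 2 * (s + d)).
  by rewrite /barrier_cubic; ring.
apply: mulr_gt0; first by lra.
(* [h1] lowers r to n - d - 2, [h2] and [h3] raise s to (n - 1) / 2, and [h4] and [h5] bound what
   remains. *)
have h1 : 0 <= (r - (n - d - 2)) * (r + (n - d - 2) - (s + d)).
  by rewrite mulr_ge0 //; lra.
have h2 : 0 <= (n - 1 - 2 * s) * (s - d - 1) by rewrite mulr_ge0 //; lra.
have h3 : 0 <= (n - 1 - 2 * s) * (n + 3 * d + 3) by rewrite mulr_ge0 //; lra.
have h4 : 0 <= (n - 5 * d - 6) * (n - 5 * d - 6) by rewrite mulr_ge0 //; lra.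
have h5 : 0 <= (n - 5 * d - 6) * d by rewrite mulr_ge0 //; lra.
nra.
Qed.

(** * Isomorphism of barrier graphs through colour classes *)

(** The i-th element of a fibre of [k] goes to the i-th element of the fibre of [k'] over the same
    colour. With fibres of equal size the default [u0] of [nth] is never reached, and exchanging [k]
    and [k'] gives the inverse. *)
Definition fiber_map (T U : finType) (C : eqType) (k : T -> C) (k' : U -> C)
    (u0 : U) (x : T) : U :=
  nth u0 (enum [pred y | k' y == k x]) (index x (enum [pred z | k z == k x])).

Section FiberMap.

Variables (T U : finType) (C : eqType) (k : T -> C) (k' : U -> C).
Hypothesis eq_fib : forall c, #|[pred x | k x == c]| = #|[pred y | k' y == c]|.

Lemma index_fiber x :
  (index x (enum [pred z | k z == k x]) < size (enum [pred y | k' y == k x]))%N.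
Proof. by rewrite -cardE -eq_fib cardE index_mem mem_enum inE. Qed.

Lemma fiber_mapP u0 x : k' (fiber_map k k' u0 x) = k x.
Proof.
by have := mem_nth u0 (index_fiber x); rewrite mem_enum inE => /eqP.
Qed.

Lemma fiber_mapK t0 u0 : cancel (fiber_map k k' u0) (fiber_map k' k t0).
Proof.
move=> x; rewrite {1}/fiber_map fiber_mapP index_uniq ?enum_uniq ?index_fiber //.
by rewrite nth_index // mem_enum inE.
Qed.

End FiberMap.

Lemma fiber_bij (T U : finType) (C : eqType) (k : T -> C) (k' : U -> C) :
    (forall c, #|[pred x | k x == c]| = #|[pred y | k' y == c]|) -> T -> U ->
  exists2 f : T -> U, bijective f & forall x, k' (f x) = k x.
Proof.
move=> eq_fib t0 u0; exists (fiber_map k k' u0); last exact: fiber_mapP.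
by exists (fiber_map k' k t0); apply: fiber_mapK.
Qed.

(** Adjacency of distinct vertices depends only on their membership in [S] and in [B], so a
    bijection preserving this pair of booleans suffices. *)
Lemma barrier_iso (T U : finType) (S B : {set T}) (S' B' : {set U}) :
    [disjoint S & B] -> [disjoint S' & B'] -> #|T| = #|U| ->
    #|S| = #|S'| -> #|B| = #|B'| -> (0 < #|T|)%N ->
  giso (barrier S B) (barrier S' B').
Proof.
move=> disj disj' eTU eS eB T_gt0.
have [u0 _] : exists u0, u0 \in U by apply/card_gt0P; rewrite -eTU.
have [t0 _] := card_gt0P T_gt0.
pose k (V : finType) (P Q : {set V}) x := (x \in P, x \in Q).
have [c|f bij_f fk] := @fiber_bij T U _ (k T S B) (k U S' B') _ t0 u0.
  have fib (V : finType) (P Q : {set V}) : [disjoint P & Q] ->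
    #|[pred x | k V P Q x == c]| =
      (if c.1 then if c.2 then 0 else #|P| else
       if c.2 then #|Q| else #|V| - (#|P| + #|Q|))%N.
    move=> dPQ; case: c => [[] []] /=.
    - apply: eq_card0 => x; rewrite !inE /k xpair_eqE !eqb_id.
      by apply/negP => /andP[Px]; rewrite (disjointFr dPQ Px).
    - apply: eq_card => x; rewrite !inE /k xpair_eqE eqb_id eqbF_neg.
      by case: (boolP (x \in P)) => // /(disjointFr dPQ) ->.
    - apply: eq_card => x; rewrite !inE /k xpair_eqE eqb_id eqbF_neg.
      by case: (boolP (x \in P)) => // /(disjointFr dPQ) ->.
    - have := cardsC (P :|: Q); rewrite cardsU (disjoint_setI0 dPQ) cards0 subn0.
      move=> <-; rewrite addKn; apply: eq_card => x.
      by rewrite !inE /k xpair_eqE !eqbF_neg negb_or.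
  by rewrite !fib // eTU eS eB.
exists f => // x y; rewrite /= /barrier_adj.
have kS z : (f z \in S') = (z \in S) by case: (fk z).
have kB z : (f z \in B') = (z \in B) by case: (fk z).
by rewrite (bij_eq bij_f) !kS !kB.
Qed.

Lemma min_degree_le (T : finType) (G : sgraph T) x : (min_degree G <= degree G x)%N.
Proof.
rewrite /min_degree; have := mem_index_enum x.
elim: (index_enum T) => // y l IHl; rewrite big_cons inE geq_min.
by case/orP=> [/eqP <-|/IHl ->]; rewrite ?leqnn ?orbT.
Qed.

(** * The extremal graph as a barrier graph *)

Section ExtremalGraph.

Variables d m : nat.
Let X := join (complete d) (disjoint_union (complete m) (edgeless (d + 1))).
Let U : finType := ('I_d + ('I_m + 'I_(d + 1)))%type.

Definition core : {set U} := [set x | if x is inl _ then true else false].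

Definition independent : {set U} :=
  [set x | if x is inr (inr _) then true else false].

Lemma core_independent : [disjoint core & independent].
Proof.
by rewrite -setI_eq0; apply/eqP/setP => -[?|[?|?]]; rewrite !inE.
Qed.

Lemma card_core : #|core| = d.
Proof.
have -> : core = inl @: [set: 'I_d].
  apply/setP => -[i|y]; rewrite inE; first by rewrite imset_f.
  by apply/esym/imsetP => -[].
by rewrite card_imset ?cardsT ?card_ord // => ? ? [].
Qed.

Lemma card_independent : #|independent| = d.+1.
Proof.
have -> : independent = (inr \o inr) @: [set: 'I_(d + 1)].
  apply/setP => -[i|[j|k]]; rewrite inE.
  - by apply/esym/imsetP => -[].
  - by apply/esym/imsetP => -[].
  - by apply/esym/imsetP; exists k.
by rewrite card_imset ?cardsT ?card_ord ?addn1 // => ? ? [].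
Qed.

Lemma extremal_barrier : X =2 barrier core independent.
Proof.
by move=> [i|[i|i]] [j|[j|j]]; rewrite /= /barrier_adj !inE /= ?andbT ?andbF.
Qed.

Lemma rho_extremal (R : realType) (r : R) (n : R := #|U|%:R) :
    0 < r -> ((0 < d)%N -> n - 2 * d%:R - 2 < r) -> barrier_cubic n d%:R r = 0 ->
    (d = 0%N -> r = n - 2) ->
  r <= rho R X.
Proof.
move=> r_gt0 r_gt cubic0 d0.
have U_gt0 : (0 < #|U|)%N by rewrite !card_sum !card_ord !addnA addn1.
have [_] := rho_max R X U_gt0; apply.
have -> : adjacency R X = adjacency R (barrier core independent).
  by apply/matrixP => i j; rewrite !mxE extremal_barrier.
apply: barrier_eigenvalue; rewrite ?card_core ?card_independent //.
- exact: core_independent.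
- by rewrite -card_gt0 card_core.
by move=> core0; apply: d0; rewrite -card_core core0 cards0.
Qed.

End ExtremalGraph.

Theorem theorem1p6 (R : realType) (T : finType) (G : sgraph T) (n delta : nat)
    (order_G : #|T| = n) (min_degree_G : min_degree G = delta)
    (n_ge : (5 * delta + 6 <= n)%N) :
  let X := join (complete delta)
                (disjoint_union (complete (n - 2 * delta - 1))
                                (edgeless (delta + 1))) in
  rho R X <= rho R G ->
  has_K2_cycle_factor G \/ giso G X.
Proof.
move=> X le_rho; have [|noF] := pselect (has_K2_cycle_factor G); first by left.
right; have [S [B [disjSB cardB BS]]] := no_factor_barrier noF.
have leST : (2 * #|S| + 1 <= n)%N.
  have := max_card (S :|: B); rewrite cardsU (disjoint_setI0 disjSB) cards0.
  by rewrite cardB order_G; lia.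
have leS : (delta <= #|S|)%N.
  (* All neighbours of a vertex of [B] lie in [S]. *)
  have [b Bb] : exists b, b \in B by apply/card_gt0P; rewrite cardB.
  rewrite -min_degree_G (leq_trans (min_degree_le G b)) //.
  by apply: subset_leq_card; apply/fintype.subsetP => y; apply: BS.
set U : finType := ('I_delta + ('I_(n - 2 * delta - 1) + 'I_(delta + 1)))%type.
have cardU : #|U| = n by rewrite !card_sum !card_ord; lia.
have n_geR : 5 * delta%:R + 6 <= n%:R :> R.
  by move: n_ge; rewrite -(ler_nat R) natrD natrM.
have d_ge0 : 0 <= delta%:R :> R by [].
have [r r_ge cubic0] := barrier_cubic_root d_ge0 n_geR.
have r_gt0 : 0 < r by lra.
(* For delta = 0 the cubic is r (r + 1) (r - (n - 2)), whose only positive root is n - 2. *)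
have delta0 : delta = 0%N -> r = n%:R - 2.
  move=> d0; have : r * (r + 1) * (r - (n%:R - 2)) = 0.
    by rewrite -[RHS]cubic0 /barrier_cubic d0; ring.
  move=> /eqP; rewrite !mulf_eq0 subr_eq0.
  by rewrite !(gt_eqF r_gt0, gt_eqF (addr_gt0 r_gt0 ltr01)) /= => /eqP.
have le_r : r <= rho R G.
  apply: le_trans le_rho; apply: rho_extremal; rewrite ?cardU //.
  by rewrite -(ltr0n R) => ?; lra.
have T_gt0 : (0 < #|T|)%N by lia.
have [Glam _] := rho_max R G T_gt0.
have leSR : delta%:R <= #|S|%:R :> R by rewrite ler_nat.
have sGM := sub_barrier BS.
have r_gt : S != set0 -> #|T|%:R - 2 * #|S|%:R - 2 < r.
  by rewrite -card_gt0 -(ltr0n R) order_G => ?; lra.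
have r_ge0 : S = set0 -> #|T|%:R - 2 <= r.
  by move=> S0; rewrite order_G delta0 //; move: leS; rewrite S0 cards0; lia.
have maxG := barrier_maximal disjSB cardB sGM r_gt0 r_gt r_ge0 _ Glam le_r.
move: leS; rewrite leq_eqVlt => /orP[/eqP eS|ltS].
  have [|eqG _] := maxG; first by rewrite order_G -eS cubic0.
  have [f bij_f fP] : giso (barrier S B)
      (barrier (core delta (n - 2 * delta - 1))
               (independent delta (n - 2 * delta - 1))).
    apply: barrier_iso; rewrite ?card_core ?card_independent ?cardB ?cardU ?eS //.
    exact: core_independent.
  by exists f => // x y; rewrite extremal_barrier fP eqG.
have ltSR : delta%:R + 1 <= #|S|%:R :> R by rewrite natr1 ler_nat.
have leSTR : 2 * #|S|%:R + 1 <= n%:R :> R.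
  by move: leST; rewrite -(ler_nat R) natrD natrM.
(* For [#|S|] above delta the cubic is positive at [r], while [maxG] would make it vanish. *)
have cubic_gt0 := barrier_cubic_incr d_ge0 n_geR ltSR leSTR r_ge.
rewrite cubic0 -order_G in cubic_gt0; have [|_ cubicS0] := maxG; first exact: ltW.
by rewrite cubicS0 ?ltxx // -card_gt0 (leq_ltn_trans _ ltS) in cubic_gt0.
Qed.
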